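(* Consider $N$ balls of $C$ different colors, with $k_c\ge1$ balls of color $c\in\{1,\dots,C\}$, $\sum_{c}k_c=N$. Let $n$ be an integer with $1\le n\le N/2$, and let $U_n$ and $V_n$ be the vectors of color counts in a sample of size $n$ drawn without replacement and with replacement, respectively. Then $$D\left(U_n\,\Vert\, V_n\right)\ \ge\ (C-1)\,\frac{r-1-\ln(r)}{2},\qquad\text{where } r=1-\frac{n-1}{N-\frac12}.$$
   Context: $U_n$ has a multivariate hypergeometric distribution and $V_n$ has the multinomial distribution with $n$ trials and probabilities $p_c=k_c/N$. $D(U_n\Vert V_n)$ denotes the information divergence $D(P\Vert Q)=\sum_i p_i\ln\frac{p_i}{q_i}$ (natural logarithm, $0\ln0=0$) of the distribution $P$ of $U_n$ from the distribution $Q$ of $V_n$. *)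

(* Defs.v *)
From HB Require Import structures.
From mathcomp Require Import all_boot all_order all_algebra.
From mathcomp Require Import all_classical all_reals all_analysis.

Set Implicit Arguments.
Unset Strict Implicit.
Unset Printing Implicit Defensive.

Import Order.TTheory GRing.Theory Num.Theory.
Local Open Scope ring_scope.

(* In [\bar R] we have 0 * x = 0 for every x, and p / 0 = +oo with
   [lne +oo = +oo] for p > 0. Hence the convention 0 ln 0 = 0 is built in, and
   the divergence is +oo as soon as P i > 0 = Q i for some i. *)
Definition divergence (R : realType) (I : finType) (P Q : I -> R) : \bar R :=
  (\sum_(i : I) (P i)%:E * lne ((P i)%:E / (Q i)%:E))%E.

(* Law of X(s), where s is drawn uniformly from the set S. *)
Definition uniform_law (R : realType) (S0 I : finType) (S : {set S0})
    (X : S0 -> I) (i : I) : R :=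
  #|[set s in S | X s == i]|%:R / #|S|%:R.

Section Sampling.
Variables (N C n : nat) (color : 'I_N -> 'I_C).

(* Samples list the balls in the order in which they are drawn. *)
Definition samples_without_replacement : {set n.-tuple 'I_N} :=
  [set s : n.-tuple 'I_N | uniq s].

Definition samples_with_replacement : {set n.-tuple 'I_N} := [set: n.-tuple 'I_N].

(* [inord] is harmless here: a count is at most n. *)
Definition color_counts (s : n.-tuple 'I_N) : {ffun 'I_C -> 'I_n.+1} :=
  [ffun c => inord (count (fun b => color b == c) s)].

End Sampling.

(* The law of U_n. *)
Definition law_without_replacement (R : realType) (N C n : nat)
    (color : 'I_N -> 'I_C) : {ffun 'I_C -> 'I_n.+1} -> R :=
  uniform_law R (samples_without_replacement N n) (@color_counts N C n color).

(* The law of V_n. *)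
Definition law_with_replacement (R : realType) (N C n : nat)
    (color : 'I_N -> 'I_C) : {ffun 'I_C -> 'I_n.+1} -> R :=
  uniform_law R (samples_with_replacement N n) (@color_counts N C n color).

Definition multivariate_hypergeometric_pmf (R : realType) (C n : nat)
    (k : 'I_C -> nat) (u : {ffun 'I_C -> 'I_n.+1}) : R :=
  if (\sum_c u c == n)%N then
    (\prod_c 'C(k c, u c))%:R / 'C(\sum_c k c, n)%:R
  else 0.

Definition multinomial_pmf (R : realType) (C n : nat)
    (p : 'I_C -> R) (u : {ffun 'I_C -> 'I_n.+1}) : R :=
  if (\sum_c u c == n)%N then
    n`!%:R / (\prod_c (u c)`!)%:R * \prod_c p c ^+ u c
  else 0.

Section Counting.
Variables (N C n : nat) (color : 'I_N -> 'I_C).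
Implicit Types (u : {ffun 'I_C -> 'I_n.+1}) (s : n.-tuple 'I_N).

Local Notation class c := [set b | color b == c].
Local Notation cnt c s := (count (fun b => color b == c) s).

Lemma color_countsE s c : color_counts color s c = cnt c s :> nat.
Proof. by rewrite ffunE inordK // ltnS -[leqRHS](size_tuple s) count_size. Qed.

Lemma color_counts_eq s u :
  (color_counts color s == u) = [forall c, cnt c s == u c].
Proof.
apply/eqP/forallP => [<- c|h]; first by rewrite color_countsE.
by apply/ffunP => c; apply/val_inj; rewrite /= color_countsE; apply/eqP.
Qed.

Lemma sum_count (t : seq 'I_N) : (\sum_c cnt c t = size t)%N.
Proof.
elim: t => [|b t IH] /=; first by rewrite big1.
rewrite big_split /= IH (bigD1 (color b)) //= eqxx big1 ?addn0 ?add1n // => c.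
by rewrite eq_sym => /negbTE ->.
Qed.

Lemma sum_color_counts s : (\sum_c color_counts color s c = n)%N.
Proof.
by under eq_bigr do rewrite color_countsE; rewrite sum_count size_tuple.
Qed.

Lemma sum_class : (\sum_c #|class c| = N)%N.
Proof.
rewrite -[RHS]card_ord -sum1_card (partition_big color predT) //=.
by apply: eq_bigr => c _; rewrite sum1dep_card.
Qed.

Lemma card_uniq_set (A : {set 'I_N}) : #|A| = n ->
  #|[set s : n.-tuple 'I_N | uniq s & [set x in s] == A]| = n`!.
Proof.
move=> cA; transitivity (#|A| ^_ n)%N; last by rewrite cA ffactnn.
rewrite -(card_uniq_tuples n (mem A)); apply: eq_card => s; rewrite !inE andbC.
case: (boolP (uniq s)) => us; rewrite ?andbF // !andbT.
apply/eqP/allP => [<- x xs|sA]; first by change (x \in [set y in s]); rewrite inE.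
apply/eqP; rewrite eqEcard cA cardsE (card_uniqP us) size_tuple leqnn andbT.
by apply/fintype.subsetP => x; rewrite inE => /sA.
Qed.

Lemma card_subsets_by_color (u : 'I_C -> nat) :
  #|[set A : {set 'I_N} | [forall c, #|A :&: class c| == u c]]|
  = (\prod_c 'C(#|class c|, u c))%N.
Proof.
pose F c := [set B : {set 'I_N} | (B \subset class c) && (#|B| == u c)].
transitivity #|family F|; last first.
  rewrite card_family foldrE big_map big_enum /=.
  by apply: eq_bigr => c _; rewrite cards_draws.
pose f (A : {set 'I_N}) : {ffun 'I_C -> {set 'I_N}} := [ffun c => A :&: class c].
have f_inj : injective f.
  move=> A B /ffunP e; apply/setP => x.
  by have /setP/(_ x) := e (color x); rewrite !ffunE !inE eqxx !andbT.
rewrite -(card_imset _ f_inj); apply: eq_card => g.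
apply/imsetP/familyP => [[A + ->] c|h].
  by rewrite inE => /forallP/(_ c) e; rewrite ffunE inE subsetIr.
have hc c x : x \in g c -> color x = c.
  have := h c; rewrite inE => /andP[/fintype.subsetP sub _] /sub.
  by rewrite inE => /eqP.
have e : g = f (\bigcup_c g c)%SET.
  apply/ffunP => c; rewrite ffunE; apply/setP => x; rewrite !inE.
  apply/idP/andP => [xg|[/bigcupP[c' _ xg] /eqP <-]].
    by split; [apply/bigcupP; exists c | apply/eqP/hc].
  by rewrite (hc _ _ xg).
exists (\bigcup_c g c)%SET => //; rewrite inE; apply/forallP => c.
move/ffunP/(_ c) : e; rewrite ffunE => <-.
by have := h c; rewrite inE => /andP[].
Qed.

Lemma card_uniq_counts u : (\sum_c u c = n)%N ->
  #|[set s in samples_without_replacement N n | color_counts color s == u]|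
  = (n`! * \prod_c 'C(#|class c|, u c))%N.
Proof.
move=> su; rewrite -card_subsets_by_color.
set D := [set A : {set 'I_N} | _].
rewrite -sum1_card
  (partition_big (fun s : n.-tuple 'I_N => [set x in s]) (mem D)) /=.
  rewrite mulnC -sum_nat_const; apply: eq_bigr => A AD.
  have AD' : forall c, #|A :&: class c| = u c.
    by move=> c; move: AD; rewrite inE => /forallP/(_ c)/eqP.
  have cA : #|A| = n.
    rewrite -su -(eq_bigr _ (fun c _ => AD' c)) -sum1_card.
    rewrite (partition_big color predT) //=; apply: eq_bigr => c _.
    by rewrite -sum1_card; apply: eq_bigl => x; rewrite !inE.
  rewrite -(card_uniq_set cA) sum1dep_card; apply: eq_card => s.
  rewrite !inE; case: (boolP (uniq s)) => //= us.
  case: ([set x in s] =P A) => [sA|]; rewrite ?andbF // andbT color_counts_eq.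
  apply/forallP => c; rewrite -AD' -sA -size_filter.
  rewrite -(card_uniqP (filter_uniq _ us)); apply/eqP/eq_card => x.
  by rewrite mem_filter !inE andbC.
move=> s; rewrite !inE color_counts_eq => /andP[us /forallP h].
apply/forallP => c; rewrite -(eqP (h c)) -size_filter.
rewrite -(card_uniqP (filter_uniq _ us)); apply/eqP/eq_card => x.
by rewrite mem_filter !inE andbC.
Qed.

Lemma card_samples_without : #|samples_without_replacement N n| = (N ^_ n)%N.
Proof.
rewrite -[in RHS](card_ord N) -(card_uniq_tuples n predT).
by apply: eq_card => s; rewrite !inE all_predT.
Qed.

Lemma card_samples_with : #|samples_with_replacement N n| = (N ^ n)%N.
Proof. by rewrite cardsT card_tuple card_ord. Qed.

End Counting.

Lemma card_counts (N C n : nat) (color : 'I_N -> 'I_C) (u : 'I_C -> nat) :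
  (\sum_c u c = n)%N ->
  (#|[set s : n.-tuple 'I_N |
       [forall c, count (fun b => color b == c) s == u c]]| * \prod_c (u c)`!
   = n`! * \prod_c #|[set b | color b == c]| ^ u c)%N.
Proof.
elim: n u => [|n IH] u su.
  have u0 c : u c = 0%N.
    by apply/eqP; rewrite -leqn0 -su (bigD1 c) //= leq_addr.
  rewrite !big1 ?muln1; do ?by move=> c _; rewrite u0.
  rewrite (_ : [set _ | _] = [set [tuple]]) ?cards1 //.
  apply/setP => s; rewrite !inE tuple0 eqxx; apply/forallP => c /=.
  by rewrite u0.
pose ue (c d : 'I_C) := (u d - (c == d))%N.
have prodD1 c (F : 'I_C -> nat -> nat) :
    (\prod_d F d (ue c d) = F c (u c).-1 * \prod_(d | d != c) F d (u d))%N.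
  rewrite (bigD1 c) //= /ue eqxx subn1; congr muln.
  by apply: eq_bigr => d; rewrite eq_sym => /negbTE ->; rewrite subn0.
pose W m (v : 'I_C -> nat) := #|[set s : m.-tuple 'I_N |
  [forall c, count (fun b => color b == c) s == v c]]|.
have Wrec : W n.+1 u = (\sum_b (0 < u (color b)) * W n (ue (color b)))%N.
  rewrite /W -sum1dep_card big_mkcond /=.
  rewrite (reindex (fun p : 'I_N * n.-tuple 'I_N => [tuple of p.1 :: p.2])) /=.
    rewrite -(pair_bigA _ (fun b t => if [forall c,
      ((color b == c) + count (fun b => color b == c) (t : n.-tuple _))%N == u c]
      then 1%N else 0%N)) /=.
    apply: eq_bigr => b _; rewrite -big_mkcond sum1dep_card /=.
    case: posnP => [u0|u_gt0]; rewrite ?mul0n ?mul1n.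
      apply: eq_card0 => t; rewrite inE; apply/negbTE/negP => /forallP.
      by move=> /(_ (color b)); rewrite eqxx u0.
    apply: eq_card => t; rewrite !inE; apply: eq_forallb => c; rewrite /ue.
    case: (eqVneq (color b) c) => [e|_]; last by rewrite subn0.
    by rewrite subn1 -e add1n -[in LHS](prednK u_gt0) eqSS.
  exists (fun s : n.+1.-tuple 'I_N => (thead s, [tuple of behead s])).
    by move=> [b t] _ /=; congr pair; apply/val_inj.
  by move=> s _; rewrite -tuple_eta.
rewrite -/(W n.+1 u) Wrec big_distrl /=.
have step b : ((0 < u (color b)) * W n (ue (color b)) * \prod_c (u c)`!
    = u (color b) * (n`! * \prod_d #|[set b | color b == d]| ^ ue (color b) d))%N.
  case: posnP => [->|u_gt0]; rewrite ?mul0n // mul1n.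
  rewrite -IH; last first.
    apply/eqP; rewrite -eqSS -su (bigD1 (color b)) //= (bigD1 (color b) (F := u)) //=.
    rewrite /ue eqxx subn1 -addSn prednK //; apply/eqP; congr addn.
    by apply: eq_bigr => d; rewrite eq_sym => /negbTE ->; rewrite subn0.
  rewrite (prodD1 _ (fun _ m => m`!)) (bigD1 (color b)) //=.
  have -> : ((u (color b))`! = u (color b) * (u (color b)).-1`!)%N.
    by rewrite -[in LHS](prednK u_gt0) factS prednK.
  by rewrite -/(W n _) -!mulnA mulnCA.
under eq_bigr do rewrite step.
rewrite (partition_big color predT) //= factS -mulnA -su big_distrl /=.
apply: eq_bigr => c _.
under eq_bigr => b /eqP -> do [].
rewrite sum_nat_cond_const; have [->|u_gt0] := posnP (u c).
  by rewrite !mul0n muln0.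
rewrite mulnCA; congr muln; rewrite mulnCA; congr muln.
by rewrite (prodD1 _ (fun d m => #|[set b | color b == d]| ^ m)%N) mulnA -expnS
  prednK // [RHS](bigD1 c).
Qed.

(* U_n is multivariate hypergeometric. *)
Lemma law_without_replacementE (R : realType) (N C n : nat)
    (color : 'I_N -> 'I_C) :
  law_without_replacement R (n := n) color =1
  multivariate_hypergeometric_pmf R (fun c => #|[set b | color b == c]|).
Proof.
move=> u; rewrite /law_without_replacement /uniform_law.
rewrite /multivariate_hypergeometric_pmf sum_class; case: eqP => [su|nsu].
  rewrite card_uniq_counts // card_samples_without -bin_ffact mulnC !natrM.
  by rewrite -mulf_div divff ?mulr1 // pnatr_eq0 -lt0n fact_gt0.
rewrite (_ : [set s in _ | _] = finset.set0) ?cards0 ?mul0r //.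
apply/setP => s; rewrite !inE; apply/negP => /andP[_ /eqP e].
by apply: nsu; rewrite -e sum_color_counts.
Qed.

(* V_n is multinomial with probabilities k_c / N. *)
Lemma law_with_replacementE (R : realType) (N C n : nat)
    (color : 'I_N -> 'I_C) :
  law_with_replacement R (n := n) color =1
  multinomial_pmf (fun c => #|[set b | color b == c]|%:R / N%:R).
Proof.
move=> u; rewrite /law_with_replacement /uniform_law /multinomial_pmf.
case: eqP => [su|nsu].
  have -> : [set s in samples_with_replacement N n | color_counts color s == u]
    = [set s : n.-tuple 'I_N | [forall c, count (fun b => color b == c) s == u c]].
    by apply/setP => s; rewrite !inE color_counts_eq.
  have := card_counts color su => /(congr1 (fun m => m%:R : R)).
  rewrite !natrM card_samples_with natrX => e.
  rewrite [X in _ = _ * X](eq_bigr (fun c =>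
    #|[set b | color b == c]|%:R ^+ u c / N%:R ^+ u c)); last first.
    by move=> c _; rewrite expr_div_n.
  rewrite big_split /= prodfV -expr_sum su mulrA; congr (_ / _).
  have f0 : (\prod_c (u c)`!)%:R != 0 :> R.
    by rewrite pnatr_eq0 -lt0n prodn_gt0 // => c; rewrite fact_gt0.
  apply: (mulIf f0); rewrite e mulrAC divfK //; congr (_ * _).
  by rewrite natr_prod; apply: eq_bigr => c _; rewrite natrX.
rewrite (_ : [set s in _ | _] = finset.set0) ?cards0 ?mul0r //.
apply/setP => s; rewrite !inE; apply/negP => /eqP e.
by apply: nsu; rewrite -e sum_color_counts.
Qed.

(* Main.v *)
Require Import Defs.
From HB Require Import structures.
From mathcomp Require Import all_boot all_order all_algebra.
From mathcomp Require Import all_classical all_reals all_analysis.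
From mathcomp Require Import ring lra zify.

Import Order.TTheory GRing.Theory Num.Theory.
Local Open Scope ring_scope.

(** Given the vector of color counts, the colors in order of drawing are
    uniformly arranged under both sampling schemes, so the divergence between
    the count vectors is the divergence between the ordered color sequences
    ([divergenceE]).  By the chain rule it is a sum over the draws
    ([sample_divergenceS]): if [n] balls are out, [m = N - n] are left and
    [Y_c] of these have color [c], the next draw contributes
      [E (\sum_c p_c * (x_c * ln x_c))], where [p_c = k_c / N] and
      [x_c = (Y_c / m) / p_c].

    The Taylor bound
      [x ln x >= (x - 1) + (x - 1)^2 / 2 - (x - 1)^3 / 6]
    ([mul_ln_ge_cubic]) replaces each term by a cubic polynomial in a
    hypergeometric variable, whose mean is explicit.  The linear terms vanish,
    and the quadratic ones sum to
      [(C - 1) * n / (2 * (N - n) * (N - 1))].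
    The cubic terms sum to a nonnegative multiple of [(2m - N) * T], where
    [T = \sum_c (N - k_c) * (N - 2 k_c) / k_c]; here [2m >= N] because at most
    half of the balls are drawn, and [T >= N * (C - 1) * (C - 2) >= 0] by
    convexity of the inverse ([sum_third_moment_ge0]).  So the cubic terms may
    be dropped ([sum_mean_color_cubic_ge]).

    It remains to compare with the closed form.  Its increment in [n] is
    [(C - 1) / 2] times
      [ln ((m + 1/2) / (m - 1/2)) - 1 / (N - 1/2)],
    and bounding that logarithm by [m / (m^2 - 1/4)], again by the Taylor
    bound, gives at most the quadratic contribution ([lower_boundS]).  Both
    sides vanish at [n = 1]. *)

Set Implicit Arguments.
Unset Strict Implicit.

(** * A cubic lower bound for x ln x *)

Section Log.
Variable R : realType.
Implicit Types x : R.

(** The difference of the two sides of [mul_ln_ge_cubic], divided by [x]: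
    after this division a single derivative has an evident sign. *)
Definition ln_cubic_gap x : R :=
  ln x + (3^-1 * x^-1 - x + 6^-1 * (x * x) + 2^-1).

Lemma is_derive_ln_cubic_gap x : 0 < x ->
  is_derive x 1 ln_cubic_gap ((x - 1) ^+ 3 / (3 * x ^+ 2)).
Proof.
move=> x_gt0; have x0 : x != 0 by rewrite gt_eqF.
have dln := is_derive1_ln x_gt0.
have dV : is_derive x 1 (fun y : R => y^-1) (- x ^- 2 *: (1 : R)).
  exact: (@is_deriveV R id x 1 1 x0 (is_derive_id _ _)).
apply: is_derive_eq.
by rewrite /GRing.scale /=; field; rewrite x0.
Qed.

(** The derivative of [ln_cubic_gap] has the sign of [x - 1], so its minimum is
    the value [0] at [x = 1]. *)
Lemma mul_ln_ge_cubic x : 0 < x ->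
  (x - 1) + (x - 1) ^+ 2 / 2 - (x - 1) ^+ 3 / 6 <= x * ln x.
Proof.
move=> x_gt0; have x0 : x != 0 by rewrite gt_eqF.
have gap1 : ln_cubic_gap 1 = 0 by rewrite /ln_cubic_gap ln1; field.
have segment a b : 0 < a -> a <= b ->
    exists2 c, c \in `[a, b] &
      ln_cubic_gap b - ln_cubic_gap a = (c - 1) ^+ 3 / (3 * c ^+ 2) * (b - a).
  move=> a_gt0 ab; apply: MVT_segment => // [y|].
    by rewrite in_itv => /andP[ay _];
      apply/is_derive_ln_cubic_gap/(lt_trans a_gt0).
  apply: derivable_within_continuous => y; rewrite in_itv => /andP[ay _].
  by have [] := is_derive_ln_cubic_gap (lt_le_trans a_gt0 ay).
have cube_ge0 (c : R) : 1 <= c -> 0 <= (c - 1) ^+ 3 / (3 * c ^+ 2).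
  move=> c1; rewrite divr_ge0 ?mulr_ge0 ?exprn_ge0 ?subr_ge0 //; lra.
have cube_le0 (c : R) : 0 < c -> c <= 1 -> (c - 1) ^+ 3 / (3 * c ^+ 2) <= 0.
  move=> c0 c1; rewrite pmulr_lle0 ?invr_gt0 ?mulr_gt0 ?exprn_gt0 //.
  by rewrite exprS mulr_le0_ge0 ?sqr_ge0 ?subr_le0.
have gap_ge0 : 0 <= ln_cubic_gap x.
  have [x1|x1] := leP 1 x.
    have [c] := segment _ _ ltr01 x1; rewrite in_itv gap1 subr0 => /andP[c1 _] ->.
    by rewrite mulr_ge0 ?subr_ge0 ?cube_ge0.
  have [c] := segment _ _ x_gt0 (ltW x1); rewrite in_itv gap1 sub0r.
  move=> /andP[xc c1] e; rewrite -oppr_le0 e.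
  by rewrite mulr_le0_ge0 ?subr_ge0 ?(ltW x1) ?cube_le0 // (lt_le_trans x_gt0).
have -> : x * ln x =
    (x - 1) + (x - 1) ^+ 2 / 2 - (x - 1) ^+ 3 / 6 + x * ln_cubic_gap x.
  by rewrite /ln_cubic_gap; field.
by rewrite lerDl mulr_ge0 // ltW.
Qed.

(** This is [mul_ln_ge_cubic] at [y = (m - 1/2) / (m + 1/2) <= 1] with the cubic
    term dropped, which is nonnegative there. *)
Lemma ln_half_step (m : R) : 2^-1 < m ->
  ln ((m + 2^-1) / (m - 2^-1)) <= m / (m ^+ 2 - 4^-1).
Proof.
move=> m_gt; set y := (m - 2^-1) / (m + 2^-1).
have p : 0 < m - 2^-1 by lra.
have q : 0 < m + 2^-1 by lra.
have y_gt0 : 0 < y by rewrite divr_gt0.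
have -> : (m + 2^-1) / (m - 2^-1) = y^-1 by rewrite /y invf_div.
rewrite lnV ?posrE // lerNl -(ler_pM2l y_gt0).
apply: le_trans (mul_ln_ge_cubic y_gt0).
have t_gt0 : 0 < (m + 2^-1)^-1 by rewrite invr_gt0.
have yE : y = 1 - (m + 2^-1)^-1 by rewrite /y; field; lra.
have -> : y * - (m / (m ^+ 2 - 4^-1)) = (y - 1) + (y - 1) ^+ 2 / 2.
  by rewrite /y; field; rewrite !lt0r_neq0 //; nra.
have -> : (y - 1) ^+ 3 = - (m + 2^-1)^-1 ^+ 3 by rewrite yE; ring.
by rewrite lerDl mulNr opprK divr_ge0 // exprn_ge0 // ltW.
Qed.

Lemma ln_prod (I : finType) (F : I -> R) : (forall i, 0 < F i) ->
  ln (\prod_i F i) = \sum_i ln (F i).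
Proof.
move=> F0; suff [] : 0 < \prod_i F i /\ ln (\prod_i F i) = \sum_i ln (F i) by [].
elim/big_rec2: _ => [|i y x _ [x0 <-]]; first by rewrite ln1.
by rewrite lnM ?posrE ?mulr_gt0.
Qed.

End Log.

(** * Means over samples drawn without replacement *)

Section Mean.
Variables (R : realType) (N : nat).
Implicit Types (n : nat) (F G : seq 'I_N -> R) (t : seq 'I_N).

(** [F] takes a plain sequence so that samples of different lengths can share
    one observable; each length-[n] sample without repetition has probability
    [1 / N ^_ n]. *)
Definition mean n F : R :=
  (\sum_(t : n.-tuple 'I_N | uniq t) F t) / (N ^_ n)%:R.

Lemma eq_mean n F G :
  (forall t, uniq t -> size t = n -> F t = G t) -> mean n F = mean n G.
Proof.
by move=> FG; congr (_ / _); apply: eq_bigr => t ut; rewrite FG ?size_tuple.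
Qed.

Lemma ler_mean n F G :
  (forall t, uniq t -> size t = n -> F t <= G t) -> mean n F <= mean n G.
Proof.
move=> FG; rewrite ler_wpM2r ?invr_ge0 //.
by apply: ler_sum => t ut; rewrite FG ?size_tuple.
Qed.

Lemma meanD n F G : mean n (fun t => F t + G t) = mean n F + mean n G.
Proof. by rewrite /mean big_split mulrDl. Qed.

Lemma meanZ n a F : mean n (fun t => a * F t) = a * mean n F.
Proof. by rewrite /mean -mulr_sumr mulrA. Qed.

Lemma mean_sum n (I : finType) (F : I -> seq 'I_N -> R) :
  mean n (fun t => \sum_i F i t) = \sum_i mean n (F i).
Proof. by rewrite /mean exchange_big mulr_suml. Qed.

Lemma mean_cst n a : (n <= N)%N -> mean n (fun=> a) = a.
Proof.
move=> nN; rewrite /mean sumr_const -cardsE (card_samples_without N n).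
by rewrite -[a *+ _]mulr_natr mulfK // pnatr_eq0 -lt0n ffact_gt0.
Qed.

(** The new ball is put in front of the sample, so that [F] is applied to a
    constructor form; by exchangeability it may be taken as the last one drawn. *)
Lemma mean_succ n F : (n < N)%N ->
  mean n.+1 F =
  mean n (fun t => (\sum_(b | b \notin t) F (b :: t)) / (N - n)%:R).
Proof.
move=> nN; rewrite /mean ffactnSr natrM invfM mulrA mulrAC -mulr_suml.
congr (_ / _ / _).
rewrite (reindex (fun p : n.-tuple 'I_N * 'I_N => [tuple of p.2 :: p.1])) /=.
  rewrite pair_big_dep /=.
  by apply: eq_bigl => -[t b] /=; rewrite andbC.
exists (fun s : n.+1.-tuple 'I_N => ([tuple of behead s], thead s)).
  by move=> [t b] _ /=; congr pair; apply/val_inj.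
by move=> s _; rewrite -tuple_eta.
Qed.

End Mean.

(** * Moments of the number of remaining balls of one color *)

Section Colors.
Variables (R : realType) (N C : nat) (color : 'I_N -> 'I_C).
Implicit Types (c : 'I_C) (t : seq 'I_N) (n i : nat).

Definition balls c := #|[set b | color b == c]|.
Definition drawn c t := count (fun b => color b == c) t.
Definition remaining c t := (balls c - drawn c t)%N.

Arguments drawn : simpl never.

Lemma card_remaining c t : uniq t ->
  (#|[set b | color b == c & b \notin t]| + drawn c t = balls c)%N.
Proof.
move=> ut; rewrite /drawn -size_filter -(card_uniqP (filter_uniq _ ut)).
rewrite addnC /balls -(cardsID [set b in t] [set b | color b == c]); congr addn.
  by apply: eq_card => b; rewrite !inE mem_filter.
by apply: eq_card => b; rewrite !inE andbC.
Qed.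

Lemma drawn_le c t : uniq t -> (drawn c t <= balls c)%N.
Proof. by move=> ut; rewrite -(card_remaining c ut) leq_addl. Qed.

Lemma remainingE c t : uniq t ->
  remaining c t = #|[set b | color b == c & b \notin t]|.
Proof. by move=> ut; rewrite /remaining -(card_remaining c ut) addnK. Qed.

Lemma remaining_cons c b t :
  remaining c (b :: t) = (remaining c t - (color b == c))%N.
Proof. by rewrite /remaining /drawn /= addnC subnDA. Qed.

Lemma sum_undrawn (h : 'I_C -> R) t : uniq t ->
  \sum_(b | b \notin t) h (color b) = \sum_c (remaining c t)%:R * h c.
Proof.
move=> ut; rewrite (partition_big color predT) //=; apply: eq_bigr => c _.
rewrite (eq_bigr (fun=> h c)) => [|b /andP[_ /eqP->] //].
rewrite sumr_const remainingE // mulr_natl; congr (_ *+ _).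
by apply: eq_card => b; rewrite !inE andbC.
Qed.

Lemma sum_remaining t : uniq t ->
  \sum_c (remaining c t)%:R = N%:R - (size t)%:R :> R.
Proof.
move=> ut; have -> : N%:R = (\sum_c balls c)%:R :> R.
  by rewrite -[in LHS](sum_class color).
rewrite -(sum_count color t) !natr_sum -sumrB.
by apply: eq_bigr => c _; rewrite natrB // drawn_le.
Qed.

(** Subtraction is that of the reals: beyond [i = y] the falling factorial
    already vanishes, so truncation makes no difference. *)
Lemma ffactrS (y i : nat) :
  (y ^_ i.+1)%:R = (y%:R - i%:R) * (y ^_ i)%:R :> R.
Proof.
rewrite ffactnSr natrM mulrC; have [iy|yi] := leqP i y; first by rewrite natrB.
by rewrite ffact_small // !mulr0.
Qed.

(** Drawing one more ball out of [m] sends [Y] to [Y - 1] with probability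
    [Y / m].  Since [Y * (Y - 1) ^_ i = (Y - i) * Y ^_ i], the conditional mean
    of the new falling factorial is [(m - i) / m] times the old one: falling
    factorials are eigenvectors of a draw, which is why moments are computed in
    this basis. *)
Lemma mean_remaining_ffact c i n : (n <= N)%N -> (i <= N)%N ->
  mean n (fun t => (remaining c t ^_ i)%:R) =
  (balls c ^_ i)%:R * ((N - n) ^_ i)%:R / (N ^_ i)%:R :> R.
Proof.
move=> nN iN; elim: n nN => [_|n IH nN].
  rewrite subn0 mulfK ?pnatr_eq0 -?lt0n ?ffact_gt0 //.
  rewrite -[RHS](mean_cst (N := N) (n := 0)) //.
  by apply: eq_mean => t _ /size0nil ->; rewrite /remaining subn0.
have m0 : (N - n)%:R != 0 :> R by rewrite pnatr_eq0 subn_eq0 -ltnNge.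
rewrite mean_succ //.
transitivity (((N - n)%:R - i%:R) / (N - n)%:R *
    mean n (fun t => (remaining c t ^_ i)%:R : R)).
  rewrite -meanZ; apply: eq_mean => t ut st; rewrite mulrAC; congr (_ / _).
  under eq_bigr do rewrite remaining_cons.
  rewrite (sum_undrawn (fun d => ((remaining c t - (d == c)) ^_ i)%:R)) //.
  rewrite natrB ?(ltnW nN) // -st -(sum_remaining ut) (bigD1 c) //=.
  rewrite [X in _ = (X - _) * _](bigD1 c) //=.
  rewrite eqxx subn1 -natrM -ffactnS ffactrS.
  under eq_bigr => d /negbTE dc do rewrite dc subn0.
  by rewrite -mulr_suml; ring.
rewrite (IH (ltnW nN)) subnS.
have E := ffactrS (N - n) i; rewrite ffactnS natrM in E.
apply: (mulfI m0); transitivity ((balls c ^_ i)%:R *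
  ((N - n)%:R * ((N - n).-1 ^_ i)%:R) / (N ^_ i)%:R : R); last by ring.
rewrite E.
by field; rewrite m0 pnatr_eq0 -lt0n ffact_gt0 iN.
Qed.

End Colors.
Arguments drawn {N C} color c t : simpl never.

(** * The chain rule for the divergence *)

Section Entropy.
Variables (R : realType) (N C : nat) (color : 'I_N -> 'I_C).
Implicit Types (c : 'I_C) (t : seq 'I_N) (n i u : nat).
Local Notation balls := (balls color).
Local Notation drawn := (drawn color).
Local Notation remaining := (remaining color).

(** The log-ratio between the probabilities of [u] given draws from [K] balls
    without and with replacement. *)
Definition ln_ffact_ratio K u : R := ln ((K ^_ u)%:R / K%:R ^+ u).

Lemma ffact_ratio_gt0 K u : (u <= K)%N -> 0 < (K ^_ u)%:R / K%:R ^+ u :> R.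
Proof.
case: u => [|u] uK; first by rewrite ffactn0 expr0 divr1.
by rewrite divr_gt0 ?exprn_gt0 ?ltr0n ?ffact_gt0 //; apply: leq_trans uK.
Qed.

Lemma ln_ffact_ratio_le1 K u : (u <= 1)%N -> (u <= K)%N ->
  ln_ffact_ratio K u = 0.
Proof.
case: u => [|[|//]] _ K0; rewrite /ln_ffact_ratio.
  by rewrite ffactn0 expr0 divr1 ln1.
by rewrite ffactn1 expr1 divff ?ln1 // pnatr_eq0 -lt0n.
Qed.

Lemma ln_ffact_ratioS K u : (u < K)%N ->
  ln_ffact_ratio K u.+1 = ln_ffact_ratio K u + ln ((K - u)%:R / K%:R).
Proof.
move=> uK; have K0 : (0 < K)%N by apply: leq_trans uK.
rewrite /ln_ffact_ratio -lnM ?posrE ?ffact_ratio_gt0 ?(ltnW uK) //; last first.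
  by rewrite divr_gt0 ?ltr0n ?subn_gt0.
by rewrite ffactnSr natrM exprSr invfM mulrACA.
Qed.

(** A color sequence has probability [\prod_c k_c ^_ u_c / N ^_ n] without and
    [\prod_c k_c ^ u_c / N ^ n] with replacement; this is the log of the ratio. *)
Definition seq_log_ratio t : R :=
  \sum_c ln_ffact_ratio (balls c) (drawn c t) - ln_ffact_ratio N (size t).

Definition sample_divergence n : R := mean n seq_log_ratio.

Hypothesis balls_gt0 : forall c, (0 < balls c)%N.

Lemma sample_divergence1 : (0 < N)%N -> sample_divergence 1 = 0.
Proof.
move=> N0; rewrite -[RHS](mean_cst (N := N) (n := 1)) //.
apply: eq_mean => t ut st; rewrite /seq_log_ratio st ln_ffact_ratio_le1 // subr0.
rewrite big1 // => c _; rewrite ln_ffact_ratio_le1 ?drawn_le //.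
by rewrite -st count_size.
Qed.

(** The share of color [c] in the divergence of the next draw's conditional law
    from the law of a color drawn with replacement. *)
Definition color_gain n c t : R := let y : R := (remaining c t)%:R in
  y / (N - n)%:R * (ln (y / (balls c)%:R) - ln ((N - n)%:R / N%:R)).

Lemma seq_log_ratio_cons b t : uniq t -> b \notin t -> (size t < N)%N ->
  seq_log_ratio (b :: t) = seq_log_ratio t +
    (ln ((remaining (color b) t)%:R / (balls (color b))%:R)
     - ln ((N - size t)%:R / N%:R)).
Proof.
move=> ut bt tN; rewrite /seq_log_ratio /= ln_ffact_ratioS //.
rewrite (bigD1 (color b)) //= [X in _ = X - _ + _](bigD1 (color b)) //=.
have -> : drawn (color b) (b :: t) = (drawn (color b) t).+1.
  by rewrite /drawn /= eqxx.
rewrite ln_ffact_ratioS; last first.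
  rewrite -(card_remaining color (color b) ut) -[ltnLHS]add0n ltn_add2r card_gt0.
  by apply/set0Pn; exists b; rewrite inE eqxx.
rewrite (eq_bigr (fun c => ln_ffact_ratio (balls c) (drawn c t)));
  first by rewrite /remaining; ring.
by move=> c cb; rewrite /drawn /= eq_sym (negbTE cb).
Qed.

(** Appending a ball of color [c] adds [ln (Y_c / k_c) - ln (m / N)] to the
    log-ratio, and this color comes up with probability [Y_c / m]. *)
Lemma sample_divergenceS n : (n < N)%N ->
  sample_divergence n.+1 =
  sample_divergence n + \sum_c mean n (color_gain n c).
Proof.
move=> nN; rewrite /sample_divergence mean_succ // -mean_sum -meanD.
have m0 : (N - n)%:R != 0 :> R by rewrite pnatr_eq0 subn_eq0 -ltnNge.
apply: eq_mean => t ut st.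
have stN : (size t < N)%N by rewrite st.
rewrite (eq_bigr _ (fun b bt => seq_log_ratio_cons ut bt stN)) st.
rewrite (sum_undrawn color (fun c => seq_log_ratio t + (ln ((remaining c t)%:R /
  (balls c)%:R) - ln ((N - n)%:R / N%:R)))) //.
under eq_bigr do rewrite mulrDr.
rewrite big_split /= -mulr_suml sum_remaining // st -natrB 1?ltnW //.
rewrite mulrDl mulrAC divff // mul1r; congr (_ + _).
by rewrite mulr_suml; apply: eq_bigr => c _; rewrite mulrAC.
Qed.

(** The gain is [p * (x * ln x)] with [p = k_c / N]; the bracket is the cubic
    minorant of [x * ln x]. *)
Definition color_cubic n c t : R :=
  let x := (remaining c t)%:R * N%:R / ((N - n)%:R * (balls c)%:R) in
  (balls c)%:R / N%:R * ((x - 1) + (x - 1) ^+ 2 / 2 - (x - 1) ^+ 3 / 6).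

Lemma color_cubic_le_gain n c t : (n < N)%N ->
  color_cubic n c t <= color_gain n c t.
Proof.
move=> nN; have m0 : 0 < (N - n)%:R :> R by rewrite ltr0n subn_gt0.
have N0 : 0 < N%:R :> R by rewrite ltr0n (leq_trans _ nN).
have K0 : 0 < (balls c)%:R :> R by rewrite ltr0n.
rewrite /color_cubic /color_gain /=; set y : R := (remaining c t)%:R.
have y_ge0 : 0 <= y by rewrite ler0n.
set x := y * N%:R / _.
have -> : y / (N - n)%:R * (ln (y / (balls c)%:R) - ln ((N - n)%:R / N%:R))
    = (balls c)%:R / N%:R *
      (x * (ln (y / (balls c)%:R) - ln ((N - n)%:R / N%:R))).
  by rewrite /x; field; rewrite !lt0r_neq0.
rewrite ler_pM2l ?divr_gt0 //; move: y_ge0; rewrite le_eqVlt => /predU1P[y0|y0].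
  (* At [x = 0] the gain is 0 and the cubic is [-1 + 1/2 + 1/6 < 0]. *)
  by rewrite /x -y0 !mul0r; lra.
rewrite -ln_div ?posrE ?divr_gt0 //.
have -> : y / (balls c)%:R / ((N - n)%:R / N%:R) = x.
  by rewrite /x; field; rewrite !lt0r_neq0.
by apply: mul_ln_ge_cubic; rewrite /x divr_gt0 ?mulr_gt0.
Qed.

(** The first summand is half the variance of [x], weighted by [p]; the second
    comes from the third central moment of a hypergeometric variable. *)
Lemma mean_color_cubic n c : (2 < N)%N -> (n < N)%N ->
  let m : R := N%:R - n%:R in let K : R := (balls c)%:R in let M : R := N%:R in
  mean n (color_cubic n c) =
  (M - m) * (M - K) / (2 * M * m * (M - 1)) +
  (M - m) * (2 * m - M) * ((M - K) * (M - 2 * K) / K) /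
  (6 * M * (M - 1) * (M - 2) * m ^+ 2).
Proof.
move=> N2 nN m K M.
have mE : (N - n)%:R = m by rewrite natrB // ltnW.
have m0 : m != 0 by rewrite -mE pnatr_eq0 subn_eq0 -ltnNge.
have K0 : K != 0 by rewrite pnatr_eq0 -lt0n.
have M0 : M != 0 by rewrite pnatr_eq0; lia.
have M1 : M - 1 != 0 by rewrite subr_eq0 -[1]/(1%:R) eqr_nat; lia.
have M2 : M - 2 != 0 by rewrite subr_eq0 eqr_nat; lia.
have ff i : (i <= N)%N -> mean n (fun t => (remaining c t ^_ i)%:R) =
    (balls c ^_ i)%:R * ((N - n) ^_ i)%:R / (N ^_ i)%:R :> R.
  by move=> iN; rewrite mean_remaining_ffact // ltnW.
pose a1 : R := K / M.
pose s : R := M / (m * K).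
(* The cubic in the basis of falling factorials, with [x = s * Y]. *)
transitivity (mean n (fun t => a1 * - 3^-1 +
  (a1 * (- s / 2 + s ^+ 2 - s ^+ 3 / 6) * (remaining c t ^_ 1)%:R +
   (a1 * (s ^+ 2 - s ^+ 3 / 2) * (remaining c t ^_ 2)%:R +
    a1 * (- s ^+ 3 / 6) * (remaining c t ^_ 3)%:R)))).
  apply: eq_mean => t _ _; rewrite /color_cubic /= mE !ffactrS ffactn0 -/K -/M.
  set y : R := (remaining c t)%:R.
  rewrite (_ : y * M / (m * K) = y * s) -/a1; last by rewrite /s mulrA.
  by field.
rewrite !meanD !meanZ !ff ?mean_cst ?(ltnW nN) //; try lia.
rewrite !ffactrS !ffactn0 mE -/K -/M /a1 /s.
by field; rewrite M0 M1 M2 m0 K0.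
Qed.

End Entropy.

(** * The divergence of the count vectors *)

Section CountDivergence.
Variables (R : realType) (N C : nat) (color : 'I_N -> 'I_C).
Local Notation balls := (balls color).
Hypothesis balls_gt0 : forall c, (0 < balls c)%N.

(** The multinomial coefficients cancel in the ratio of the two laws of a count
    vector, which leaves the ratio for any one sequence with these counts; the
    mean over samples then regroups according to the counts. *)
Lemma divergenceE n : (0 < N)%N -> (n <= N)%N ->
  divergence (@law_without_replacement R N C n color)
             (@law_with_replacement R N C n color)
  = (sample_divergence R color n)%:E.
Proof.
move=> N0 nN; rewrite /divergence.
pose P := @law_without_replacement R N C n color.
pose L (u : {ffun 'I_C -> 'I_n.+1}) : R :=
  \sum_c ln_ffact_ratio R (balls c) (u c) - ln_ffact_ratio R N n.
have term u : ((P u)%:E * lne ((P u)%:E / (law_with_replacement R color u)%:E)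
    = (P u * L u)%:E)%E.
  have [Pu0|Pu0] := eqVneq (P u) 0; first by rewrite Pu0 !mul0r mul0e.
  move: Pu0; rewrite /P law_without_replacementE law_with_replacementE.
  rewrite /multivariate_hypergeometric_pmf /multinomial_pmf sum_class.
  case: ifP => [/eqP su|_]; last by rewrite eqxx.
  rewrite mulf_eq0 negb_or pnatr_eq0 => /andP[A0 _].
  have uk c : (u c <= balls c)%N.
    by move: A0; rewrite (bigD1 c) //= muln_eq0 negb_or -lt0n bin_gt0 => /andP[].
  set A := (\prod_c 'C(_, _))%N in A0 *; set f := (\prod_c (u c)`!)%N.
  have f0 : f%:R != 0 :> R.
    by rewrite pnatr_eq0 -lt0n prodn_gt0 // => c; rewrite fact_gt0.
  have AR : A%:R != 0 :> R by rewrite pnatr_eq0.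
  have B0 : 'C(N, n)%:R != 0 :> R by rewrite pnatr_eq0 -lt0n bin_gt0.
  have n0 : n`!%:R != 0 :> R by rewrite pnatr_eq0 -lt0n fact_gt0.
  set p := \prod_c _.
  have p0 : 0 < p.
    apply: prodr_gt0 => c _; rewrite exprn_gt0 // divr_gt0 ?ltr0n //.
    exact: balls_gt0.
  have Q0 : n`!%:R / f%:R * p != 0.
    by rewrite mulf_neq0 ?mulf_neq0 ?invr_eq0 // gt_eqF.
  have ratioE : A%:R / 'C(N, n)%:R / (n`!%:R / f%:R * p) =
      (\prod_c ((balls c ^_ (u c))%:R / (balls c)%:R ^+ u c)) /
      ((N ^_ n)%:R / N%:R ^+ n).
    rewrite big_split /= -natr_prod.
    have -> : (\prod_c balls c ^_ u c = A * f)%N.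
      by rewrite /A /f -big_split; apply: eq_bigr => c _; rewrite /= bin_ffact.
    rewrite -bin_ffact !natrM.
    have -> : p = (\prod_c (balls c)%:R ^+ u c) / N%:R ^+ n.
      rewrite /p; under eq_bigr do rewrite expr_div_n.
      by rewrite big_split /= prodfV -expr_sum su.
    rewrite prodfV.
    have Nn0 : N%:R ^+ n != 0 :> R.
      by rewrite expf_neq0 // pnatr_eq0 -lt0n.
    have k0 : \prod_c (balls c)%:R ^+ u c != 0 :> R.
      by apply/prodf_neq0 => c _; rewrite expf_neq0 // pnatr_eq0 -lt0n.
    by field; rewrite f0 B0 n0 Nn0 k0.
  rewrite inver (negbTE Q0) -!EFinM ratioE.
  have ratio_gt0 :
      0 < \prod_c ((balls c ^_ (u c))%:R / (balls c)%:R ^+ u c) :> R.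
    by apply: prodr_gt0 => c _; rewrite ffact_ratio_gt0.
  have N_gt0 := ffact_ratio_gt0 R nN.
  rewrite lne_EFin; last exact: divr_gt0.
  rewrite -EFinM ln_div ?posrE // -/(ln_ffact_ratio R N n).
  congr (_ * (_ - _))%:E.
  by rewrite ln_prod // => c; rewrite ffact_ratio_gt0.
under eq_bigr do rewrite term.
rewrite sumEFin; congr _%:E.
rewrite /sample_divergence /mean.
rewrite (partition_big (fun t : n.-tuple 'I_N => color_counts color t) predT)
  //=.
rewrite mulr_suml; apply: eq_bigr => u _.
rewrite (eq_bigr (fun=> L u)); last first.
  move=> t /andP[_ /eqP <-]; rewrite /seq_log_ratio size_tuple.
  by congr (_ - _); apply: eq_bigr => c _; rewrite color_countsE.
rewrite sumr_const -[L u *+ _]mulr_natl [RHS]mulrAC; congr (_ * _).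
rewrite /P /law_without_replacement /uniform_law card_samples_without.
congr (_%:R / _).
by apply: eq_card => t; rewrite !inE.
Qed.

End CountDivergence.

(** * The lower bound *)

Section Bound.
Variables (R : realType) (N C : nat) (color : 'I_N -> 'I_C).
Implicit Types (c : 'I_C) (t : seq 'I_N) (n : nat).
Local Notation balls := (balls color).
Hypothesis balls_gt0 : forall c, (0 < balls c)%N.

Lemma sum_balls : \sum_c (balls c)%:R = N%:R :> R.
Proof. by rewrite -natr_sum [in RHS](esym (sum_class color)). Qed.

Lemma sum_cst_color (a : R) : \sum_(c : 'I_C) a = C%:R * a.
Proof. by rewrite sumr_const card_ord mulr_natl. Qed.

Lemma colors_gt0 : (0 < N)%N -> (0 < C)%N.
Proof. by move=> N0; case: (C) (color (Ordinal N0)) => // -[]. Qed.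

(** With [M = N], each [M / k_c] is bounded below by its tangent
    [2 C - C^2 k_c / M] at [k_c = M / C]; the total is [M (C - 1) (C - 2)], which
    is nonnegative because [C] is an integer. *)
Lemma sum_third_moment_ge0 : (0 < N)%N ->
  0 <= \sum_c
    (N%:R - (balls c)%:R) * (N%:R - 2 * (balls c)%:R) / (balls c)%:R :> R.
Proof.
move=> N_gt0; set M : R := N%:R.
have C_gt0 := colors_gt0 N_gt0.
have M_gt0 : 0 < M by rewrite ltr0n.
apply: (@le_trans _ _ (\sum_c
  (M * (2 * C%:R - 3) + (2 - C%:R ^+ 2) * (balls c)%:R))); last first.
  apply: ler_sum => c _; set K : R := (balls c)%:R.
  have K0 : 0 < K by rewrite ltr0n.
  rewrite ler_pdivlMr //.
  by have := sqr_ge0 (M - C%:R * K); nra.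
rewrite big_split /= sum_cst_color -mulr_sumr sum_balls -/M.
have [C1|C2] : C = 1%N \/ (1 < C)%N by lia.
  by rewrite C1; nra.
have C2R : 2 <= C%:R :> R by rewrite (ler_nat _ 2).
have -> : C%:R * (M * (2 * C%:R - 3)) + (2 - C%:R ^+ 2) * M =
  M * ((C%:R - 1) * (C%:R - 2)) by ring.
by rewrite !mulr_ge0 // subr_ge0 // ler1n.
Qed.

(** Drawing at most half of the balls makes [2 m - N >= 0], hence the third-order
    part is nonnegative. *)
Lemma sum_mean_color_cubic_ge n : (2 < N)%N -> (n.*2 <= N)%N ->
  (C%:R - 1) * (n%:R / (2 * (N%:R - n%:R) * (N%:R - 1))) <=
  \sum_c mean n (color_cubic R color n c).
Proof.
move=> N2 nN; have nltN : (n < N)%N by lia.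
under eq_bigr do rewrite mean_color_cubic //=.
set M : R := N%:R.
have M2 : 2 < M by rewrite (ltr_nat _ 2).
have n0 : 0 <= n%:R :> R by [].
have nM : 2 * n%:R <= M by rewrite -natrM ler_nat; lia.
set m := M - n%:R.
have m0 : 0 < m by rewrite /m; lra.
rewrite big_split /= -mulr_suml -[X in X / _ + _]mulr_sumr.
rewrite sumrB sum_cst_color sum_balls -/M.
rewrite -mulr_suml -mulr_sumr.
rewrite (_ : (C%:R - 1) * _ =
  (M - m) * (C%:R * M - M) / (2 * M * m * (M - 1))); last first.
  by rewrite /m; field; rewrite !lt0r_neq0 //; lra.
rewrite lerDl divr_ge0 ?mulr_ge0 ?sum_third_moment_ge0 ?exprn_ge0 ?(ltW m0) //;
  try lia; rewrite /m; lra.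
Qed.

Definition lower_bound n : R :=
  let r := 1 - (n%:R - 1) / (N%:R - 1 / 2) in
  (C%:R - 1) * ((r - 1 - ln r) / 2).

(** With [m = N - n], the fraction [n / (m (N - 1))] exceeds
    [1 / m - 1 / (N - 1/2)] by at least [1 / (2 (N - 1) m)], a quantity of second
    order, while [ln ((m + 1/2) / (m - 1/2))] exceeds [1 / m] only at third
    order. *)
Lemma lower_boundS n : (0 < n)%N -> (n.*2 < N)%N ->
  lower_bound n.+1 - lower_bound n <=
  (C%:R - 1) * (n%:R / (2 * (N%:R - n%:R) * (N%:R - 1))).
Proof.
move=> n0 nN; rewrite /lower_bound -natr1 /=.
have C1 : 0 <= C%:R - 1 :> R by rewrite subr_ge0 ler1n colors_gt0 //; lia.
rewrite -mulrBr ler_wpM2l //.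
set M : R := N%:R. set x : R := n%:R.
have x1 : 1 <= x by rewrite ler1n.
have xM : 2 * x + 1 <= M by rewrite -natrM natr1 ler_nat; lia.
set m := M - x.
have m_gt : 1 < m by rewrite /m; lra.
have M0 : 0 < M - 1 / 2 by lra.
have rS : 1 - (x + 1 - 1) / (M - 1 / 2) = (m - 2^-1) / (M - 1 / 2).
  by rewrite /m; field; lra.
have rn : 1 - (x - 1) / (M - 1 / 2) = (m + 2^-1) / (M - 1 / 2).
  by rewrite /m; field; lra.
rewrite rS rn.
have -> : ln ((m + 2^-1) / (M - 1 / 2)) =
    ln ((m - 2^-1) / (M - 1 / 2)) + ln ((m + 2^-1) / (m - 2^-1)).
  rewrite -lnM ?posrE ?divr_gt0 //; try lra.
  by congr ln; field; lra.
have step : ln ((m + 2^-1) / (m - 2^-1)) <= m / (m ^+ 2 - 4^-1).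
  by apply: ln_half_step; lra.
set l1 := ln _ in step *. set l0 := ln _.
(* Clearing denominators, this is
   [(2M - 1) (M - 1) <= (2M - 1 - m) (4 m^2 - 1)]; it holds since
   [M <= 2M - 1 - m] and, as [2m > M], [2 (M - 1) <= 4 m^2 - 1]. *)
have key : m / (m ^+ 2 - 4^-1) - (M - 1 / 2)^-1 <= x / (m * (M - 1)).
  rewrite -subr_ge0.
  have -> : x / (m * (M - 1)) - (m / (m ^+ 2 - 4^-1) - (M - 1 / 2)^-1) =
    ((2 * M - 1 - m) * (4 * m ^+ 2 - 1) - (2 * M - 1) * (M - 1)) /
    (m * (M - 1) * (2 * M - 1) * (4 * m ^+ 2 - 1)).
    by rewrite /m; field; rewrite -/m; rewrite !lt0r_neq0 //; nra.
  have m2 : 0 < 4 * m ^+ 2 - 1 by nra.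
  rewrite divr_ge0 ?mulr_ge0 ?(ltW m2) //; try lra.
  rewrite subr_ge0.
  have h1 : 2 * (M - 1) <= 4 * m ^+ 2 - 1 by rewrite /m; nra.
  have h2 : M <= 2 * M - 1 - m by rewrite /m; lra.
  apply: (@le_trans _ _ (M * (4 * m ^+ 2 - 1))); last first.
    by rewrite ler_wpM2r // ltW.
  by apply: (@le_trans _ _ (M * (2 * (M - 1)))); [nra|rewrite ler_wpM2l //; lra].
rewrite (_ : x / (2 * m * (M - 1)) = x / (m * (M - 1)) / 2); last first.
  by field; rewrite !lt0r_neq0 //; lra.
have -> : ((m - 2^-1) / (M - 1 / 2) - 1 - l0) / 2 -
    ((m + 2^-1) / (M - 1 / 2) - 1 - (l0 + l1)) / 2
  = (l1 - (M - 1 / 2)^-1) / 2 by field; lra.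
by rewrite ler_pM2r //; lra.
Qed.

Lemma lower_bound_le n : (0 < n)%N -> (n.*2 <= N)%N ->
  lower_bound n <= sample_divergence R color n.
Proof.
move=> n0 nN; have N0 : (0 < N)%N by lia.
elim: n n0 nN => // -[|n] IH _ nN.
  rewrite sample_divergence1 // /lower_bound /= subrr mul0r subr0 ln1.
  by rewrite subrr subr0 mul0r mulr0.
rewrite sample_divergenceS //; last by lia.
have {}IH : lower_bound n.+1 <= sample_divergence R color n.+1.
  by apply: IH; lia.
rewrite -[leLHS](subrK (lower_bound n.+1)) addrC lerD //.
apply: (@le_trans _ _ (\sum_c mean n.+1 (color_cubic R color n.+1 c))).
  apply: le_trans (sum_mean_color_cubic_ge _ _) => //; try lia.
  by apply: lower_boundS => //; lia.
apply: ler_sum => c _; apply: ler_mean => t _ _.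
by apply: color_cubic_le_gain => //; lia.
Qed.

End Bound.

Unset Implicit Arguments.

Theorem theorem4p5 (R : realType) (N C n : nat) (k : 'I_C -> nat)
    (color : 'I_N -> 'I_C)
    (k_ge1 : forall c : 'I_C, (1 <= k c)%N)
    (sum_k : (\sum_(c < C) k c)%N = N)
    (card_color : forall c : 'I_C, #|[set b : 'I_N | color b == c]%SET| = k c)
    (n_ge1 : (1 <= n)%N) (n_le : n%:R <= N%:R / 2 :> R) :
  let r : R := 1 - (n%:R - 1) / (N%:R - 1 / 2) in
  (((C%:R - 1) * ((r - 1 - ln r) / 2))%:E
    <= divergence (@law_without_replacement R N C n color)
                  (@law_with_replacement R N C n color))%E.
Proof.
have N0 : (0 < N)%N.
  rewrite lt0n; apply/eqP => N0; move: n_le.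
  by rewrite N0 mul0r leNgt ltr0n n_ge1.
have nN : (n.*2 <= N)%N.
  by move: n_le; rewrite ler_pdivlMr // -natrM ler_nat muln2.
have balls_gt0 c : (0 < balls color c)%N by rewrite /balls card_color.
cbv zeta; rewrite divergenceE //; last by lia.
by rewrite lee_fin; apply: lower_bound_le.
Qed.
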